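(* Let $r\ge2$, let $\mathbf F$ be a classical multivariate fidelity of $r$ commuting states (the average pairwise fidelity, the Matusita fidelity, or an average $k$-wise fidelity), and let $\overline{\mathbf F}$ be its maximal extension (measured multivariate fidelity). (a) If $\mathbf F$ satisfies data processing, symmetry, faithfulness, and the direct-sum property, then $\overline{\mathbf F}$ satisfies data processing, symmetry, faithfulness, and the direct-sum property on all tuples of quantum states. (b) If $\mathbf F$ is the average pairwise fidelity, then $\overline{\mathbf F}$ also satisfies orthogonality: $\overline{\mathbf F}(\rho_1,\ldots,\rho_r)=0$ if and only if $\rho_i\rho_j=0$ for all $i\ne j$. (c) If $\mathbf F$ is the Matusita fidelity or an average $k$-wise fidelity, then $\overline{\mathbf F}$ satisfies weak orthogonality only: if $\rho_i\rho_j=0$ for all $i\neq j$, then $\overline{\mathbf F}(\rho_1,\ldots,\rho_r)=0$, but the converse implication does not hold in general (for the average $k$-wise fidelities, this failure of the converse refers to $r\ge3$ and $3\le k\le r$).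
   Context: All Hilbert spaces are finite-dimensional and complex. A quantum state is a positive semi-definite operator of unit trace; a channel is a completely positive trace-preserving linear map (input and output dimensions may differ). For commuting states let $(\rho_i(x))_x$ be the eigenvalues of $\rho_i$ in a common eigenbasis. Classical multivariate fidelities: average pairwise fidelity $\frac{2}{r(r-1)}\sum_{i<j}\sum_x\sqrt{\rho_i(x)\rho_j(x)}$; Matusita fidelity $F_r(\rho_1,\dots,\rho_r)=\sum_x(\rho_1(x)\cdots\rho_r(x))^{1/r}$; average $k$-wise fidelity ($r\ge3$, $2\le k\le r$) $\binom rk^{-1}\sum_{i_1<\cdots<i_k}\sum_x(\rho_{i_1}(x)\cdots\rho_{i_k}(x))^{1/k}$. Maximal extension: $\overline{\mathbf F}(\rho_1,\ldots,\rho_r)=\inf_{(\Lambda_x)_x}\mathbf F(\Lambda(\rho_1),\ldots,\Lambda(\rho_r))$, the infimum being over all finite-outcome POVMs $(\Lambda_x)_x$ ($\Lambda_x\ge0$, $\sum_x\Lambda_x=I$) with associated measurement channel $\Lambda(\rho)=\sum_x\operatorname{Tr}[\Lambda_x\rho]|x\rangle\langle x|$, $\{|x\rangle\}$ an orthonormal basis. Properties of a fidelity $\mathbf G$ (on all states, or, for a classical $\mathbf F$, on commuting states with channels mapping commuting/diagonal states to commuting/diagonal states): - data processing: $\mathbf G(\rho_1,\ldots,\rho_r)\le\mathbf G(\mathcal N(\rho_1),\ldots,\mathcal N(\rho_r))$ for every channel $\mathcal N$; - symmetry: invariance under permutations of the arguments; - faithfulness: $\mathbf G(\rho_1,\ldots,\rho_r)=1$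 iff $\rho_1=\cdots=\rho_r$; - direct-sum property: $\mathbf G\big(\sum_xp(x)|x\rangle\langle x|\otimes\rho_1^x,\ldots,\sum_xp(x)|x\rangle\langle x|\otimes\rho_r^x\big)=\sum_xp(x)\mathbf G(\rho_1^x,\ldots,\rho_r^x)$ for every probability distribution $p$ on a finite alphabet and all states $\rho_i^x$.
   Formalization: In (c), the failure of the converse for the Matusita fidelity is stated for every r ≥ 3 only; at r = 2 the Matusita fidelity equals the average pairwise fidelity, for which the converse holds by (b). *)

(* Defs.v *)
From HB Require Import structures.
From mathcomp Require Import all_boot all_order all_algebra all_fingroup.
From mathcomp Require Import spectral.
From mathcomp Require Import complex mxtens.
From mathcomp Require Import all_classical all_reals all_analysis.

Set Implicit Arguments.
Unset Strict Implicit.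
Unset Printing Implicit Defensive.

Import Order.TTheory GRing.Theory Num.Theory.

Local Open Scope ring_scope.
Local Open Scope classical_set_scope.
Local Open Scope complex_scope.
Local Open Scope sesquilinear_scope.

(** ** States, channels and measurements

    Operators on an [n]-dimensional complex Hilbert space are matrices
    ['M[R[i]]_n], and a [{linear 'M[R[i]]_n -> 'M[R[i]]_m}] is a linear map on
    operators. *)

Section States.
Variable R : realType.
Local Notation C := R[i].

(* In the partial order of [C], [0 <= z] means that [z] is real and
   nonnegative, so this condition forces [A] to be Hermitian. *)
Definition psdmx n (A : 'M[C]_n) : Prop :=
  forall v : 'rV[C]_n, 0 <= (v *m A *m v ^t*) 0 0.

Definition state n (rho : 'M[C]_n) : Prop := psdmx rho /\ \tr rho = 1.

(* [id_k (x) N]: block [(a, b)] of [X] is the ['M_n] that multiplies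
   [|a><b|] in the decomposition of [X] along the first tensor factor. *)
Definition ampliation k n m (N : 'M[C]_n -> 'M[C]_m) (X : 'M[C]_(k * n)) :
    'M[C]_(k * m) :=
  \sum_(a < k) \sum_(b < k) tensmx (delta_mx a b)
     (N (\matrix_(i < n, j < n) X (mxtens_index (a, i)) (mxtens_index (b, j)))).

Definition completely_positive n m (N : 'M[C]_n -> 'M[C]_m) : Prop :=
  forall k (X : 'M[C]_(k * n)), psdmx X -> psdmx (ampliation N X).

Definition trace_preserving n m (N : 'M[C]_n -> 'M[C]_m) : Prop :=
  forall X : 'M[C]_n, \tr (N X) = \tr X.

Definition channel n m (N : {linear 'M[C]_n -> 'M[C]_m}) : Prop :=
  completely_positive N /\ trace_preserving N.

Definition povm n m (L : 'I_m -> 'M[C]_n) : Prop :=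
  (forall x, psdmx (L x)) /\ \sum_x L x = 1%:M.

Definition measurement n m (L : 'I_m -> 'M[C]_n) (rho : 'M[C]_n) : 'M[C]_m :=
  \sum_x \tr (L x *m rho) *: delta_mx x x.

End States.

(** ** Multivariate fidelities *)

Section Fidelities.
Variables (R : realType) (r : nat).
Local Notation C := R[i].

(* A function of [r]-tuples of operators, in every dimension. *)
Definition fidelity := forall n, ('I_r -> 'M[C]_n) -> R.

Definition domain := forall n, ('I_r -> 'M[C]_n) -> Prop.

Definition all_states : domain := fun n rho => forall i, state (rho i).

Definition commuting_states : domain := fun n rho =>
  (forall i, state (rho i)) /\ (forall i j, comm_mx (rho i) (rho j)).

(* The rows of the unitary [U] are the bras of a common orthonormal eigenbasis,
   and [p i x] is the eigenvalue of [rho i] on the [x]-th vector of it. *)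
Definition joint_spectrum n (rho : 'I_r -> 'M[C]_n) (p : 'M[R]_(r, n)) : Prop :=
  exists2 U : 'M[C]_n, U \is unitarymx &
    forall i, rho i = U ^t* *m diag_mx (\row_x (p i x)%:C) *m U.

(* The value of [f] on the eigenvalues of a commuting tuple of states, in some
   common eigenbasis. For the functions [f] below it does not depend on the
   eigenbasis, because another choice only permutes the columns of [p].
   Without common eigenbasis the value is a default without meaning. *)
Definition on_commuting (f : forall n, 'M[R]_(r, n) -> R) : fidelity :=
  fun n rho => f n (xget 0 [set p | joint_spectrum rho p]).

Definition average_pairwise_fidelity : fidelity := on_commuting (fun n p =>
  2 / (r%:R * (r%:R - 1)) *
    \sum_(i < r) \sum_(j < r | (i < j)%N) \sum_x Num.sqrt (p i x * p j x)).

Definition matusita_fidelity : fidelity := on_commuting (fun n p =>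
  \sum_x (\prod_i p i x) `^ (r%:R^-1)).

Definition average_kwise_fidelity (k : nat) : fidelity :=
  on_commuting (fun n p =>
    ('C(r, k)%:R)^-1 *
      \sum_(I : {set 'I_r} | #|I| == k)
        \sum_x (\prod_(i in I) p i x) `^ (k%:R^-1)).

Definition is_average_kwise (F : fidelity) : Prop :=
  exists k, [/\ (3 <= r)%N, (2 <= k <= r)%N & F = average_kwise_fidelity k].

Definition classical_fidelity (F : fidelity) : Prop :=
  [\/ F = average_pairwise_fidelity, F = matusita_fidelity
    | is_average_kwise F].

Definition maximal_extension (F : fidelity) : fidelity := fun n rho =>
  inf [set v : R | exists m (L : 'I_m -> 'M[C]_n),
         povm L /\ v = F m (fun i => measurement L (rho i))].

(** ** Properties of a fidelity [G] on a domain [D] of tuples of states *)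

(* On [all_states] the condition on the output tuple is automatic; on
   [commuting_states] it selects the channels that keep the tuple in the
   domain of [G]. *)
Definition data_processing (D : domain) (G : fidelity) : Prop :=
  forall n m (rho : 'I_r -> 'M[C]_n) (N : {linear 'M[C]_n -> 'M[C]_m}),
    D n rho -> channel N -> D m (fun i => N (rho i)) ->
    G n rho <= G m (fun i => N (rho i)).

Definition symmetry (D : domain) (G : fidelity) : Prop :=
  forall n (rho : 'I_r -> 'M[C]_n) (s : 'S_r),
    D n rho -> G n (fun i => rho (s i)) = G n rho.

Definition faithfulness (D : domain) (G : fidelity) : Prop :=
  forall n (rho : 'I_r -> 'M[C]_n),
    D n rho -> (G n rho = 1 <-> forall i j, rho i = rho j).

Definition direct_sum_property (D : domain) (G : fidelity) : Prop :=
  forall a n (p : 'I_a -> R) (rho : 'I_a -> 'I_r -> 'M[C]_n),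
    (forall x, 0 <= p x) -> \sum_x p x = 1 -> (forall x, D n (rho x)) ->
    G (a * n)%N (fun i =>
        \sum_x (p x)%:C *: tensmx (delta_mx x x : 'M[C]_a) (rho x i)) =
      \sum_x p x * G n (rho x).

Definition pairwise_orthogonal n (rho : 'I_r -> 'M[C]_n) : Prop :=
  forall i j, i != j -> rho i *m rho j = 0.

Definition orthogonality (G : fidelity) : Prop :=
  forall n (rho : 'I_r -> 'M[C]_n), all_states rho ->
    (G n rho = 0 <-> pairwise_orthogonal rho).

Definition weak_orthogonality (G : fidelity) : Prop :=
  forall n (rho : 'I_r -> 'M[C]_n), all_states rho ->
    pairwise_orthogonal rho -> G n rho = 0.

Definition converse_orthogonality_fails (G : fidelity) : Prop :=
  exists n (rho : 'I_r -> 'M[C]_n),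
    [/\ all_states rho, G n rho = 0 & ~ pairwise_orthogonal rho].

End Fidelities.

(* Main.v *)
(** A POVM turns the states into probability vectors, and each classical
    fidelity is then a sum over the outcomes of a function [g] of the joint
    outcome probabilities, where [g] is a nonnegative combination of geometric
    means: nonnegative, homogeneous of degree one and superadditive (Mahler).

    Data processing holds because the dual of a channel maps POVMs to POVMs.
    For the direct sum, a POVM on the whole space restricts to a POVM on each
    block, and superadditivity of [g] bounds the sum over the blocks. For
    faithfulness, the rank-one measurement in an eigenbasis of
    [rho i - rho j] detects every nonzero eigenvalue of this difference.

    Orthogonal states are distinguished by their support projections.
    Conversely, write [rho i] as [A^* A] and [rho j] as [B^* B]: by
    Cauchy-Schwarz the entries of [A B^*] bound the measured pairwise fidelity
    from below, uniformly in the POVM, so these entries vanish if the infimum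
    does. This converse fails for geometric means of at least three
    probabilities: they do not see that two states coincide if all other pairs
    are orthogonal. *)

Require Import Defs.
From mathcomp Require Import all_boot all_order all_algebra.
From mathcomp Require Import spectral complex mxtens.
From mathcomp Require Import all_classical all_reals all_analysis.

Set Implicit Arguments.
Unset Strict Implicit.
Unset Printing Implicit Defensive.

Import Order.TTheory GRing.Theory Num.Theory.

Local Open Scope ring_scope.
Local Open Scope classical_set_scope.
Local Open Scope complex_scope.
Local Open Scope sesquilinear_scope.

(** * Positive operators *)

Section PositiveOperators.
Variable R : realType.
Local Notation C := R[i].

Lemma trmxC_mul m n p (A : 'M[C]_(m, n)) (B : 'M[C]_(n, p)) :
  (A *m B) ^t* = B ^t* *m A ^t*.
Proof. by rewrite trmx_mul map_mxM. Qed.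

Lemma trmxCE m n (A : 'M[C]_(m, n)) i j : (A ^t*) i j = ((A j i)^*)%R.
Proof. by rewrite !mxE. Qed.

Lemma trmxCB m n (A B : 'M[C]_(m, n)) : (A - B) ^t* = A ^t* - B ^t*.
Proof. by apply/matrixP=> i j; rewrite !mxE rmorphB. Qed.

Lemma trmxCD m n (A B : 'M[C]_(m, n)) : (A + B) ^t* = A ^t* + B ^t*.
Proof. by apply/matrixP=> i j; rewrite !mxE rmorphD. Qed.

Lemma trmxCZ m n a (A : 'M[C]_(m, n)) : (a *: A) ^t* = (a^*)%R *: A ^t*.
Proof. by apply/matrixP=> i j; rewrite !mxE rmorphM. Qed.

Lemma trmxC1 n : (1%:M : 'M[C]_n) ^t* = 1%:M.
Proof. by rewrite trmx1 map_mx1. Qed.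

Lemma trmxC_row m n (A : 'M[C]_(m, n)) i : (row i A) ^t* = col i (A ^t*).
Proof. by apply/matrixP=> a b; rewrite !mxE. Qed.

Lemma sandwich_row m n p (A : 'M[C]_(m, n)) (B : 'M[C]_n) (D : 'M[C]_(p, n)) k l :
  (A *m B *m D ^t*) k l = (row k A *m B *m (row l D) ^t*) 0 0.
Proof. by rewrite trmxC_row colE mulmxA -!row_mul -colE !mxE. Qed.

Lemma sandwich_delta n (A : 'M[C]_n) i j :
  A i j = ((delta_mx 0 i : 'rV_n) *m A *m (delta_mx 0 j : 'rV_n) ^t*) 0 0.
Proof.
by rewrite -!row1 -sandwich_row trmxC1 mul1mx mulmx1.
Qed.

(* Polarization: over the complex numbers a quadratic form determines its
   sesquilinear form. *)
Lemma quadratic_form_eq0 n (A : 'M[C]_n) :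
  (forall v : 'rV[C]_n, (v *m A *m v ^t*) 0 0 = 0) -> A = 0.
Proof.
move=> A0; apply/matrixP=> i j; rewrite sandwich_delta [RHS]mxE.
set u : 'rV_n := delta_mx 0 i; set v : 'rV_n := delta_mx 0 j.
pose b (x y : 'rV[C]_n) := (x *m A *m y ^t*) 0 0.
have bZ (c : C) : (c^*)%R * b u v + c * b v u = 0.
  have := A0 (u + c *: v).
  have D (X Y : 'M[C]_1) : (X + Y) 0 0 = X 0 0 + Y 0 0 by rewrite mxE.
  have Z a (X : 'M[C]_1) : (a *: X) 0 0 = a * X 0 0 by rewrite mxE.
  rewrite trmxCD trmxCZ !mulmxDl !mulmxDr -!scalemxAl -!scalemxAr !(D, Z).
  by rewrite (A0 u) (A0 v) !mulr0 add0r addr0.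
have h1 := bZ 1; have hi := bZ 'i.
rewrite conjC1 !mul1r in h1; rewrite conjCi in hi.
have i0 : ('i : C) != 0 by exact: neq0Ci.
have : 'i * (b v u - b u v) = 0 by rewrite mulrBr -hi mulNr addrC.
move/eqP; rewrite mulf_eq0 (negbTE i0) /= subr_eq0 => /eqP e.
by apply/eqP; move/eqP: h1; rewrite e -mulr2n mulrn_eq0.
Qed.

Lemma psd_trmxC n (A : 'M[C]_n) : psdmx A -> A ^t* = A.
Proof.
move=> psdA; apply/eqP; rewrite -subr_eq0; apply/eqP/quadratic_form_eq0 => v.
rewrite mulmxBr mulmxBl mxE [X in _ + X]mxE; apply/eqP; rewrite subr_eq0; apply/eqP.
have -> : v *m A ^t* *m v ^t* = (v *m A *m v ^t*) ^t*.
  by rewrite !trmxC_mul trmxCK mulmxA.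
by rewrite trmxCE; apply: conj_Creal; apply: ger0_real; exact: psdA.
Qed.

Lemma psd_conj n m (A : 'M[C]_n) (B : 'M[C]_(m, n)) :
  psdmx A -> psdmx (B *m A *m B ^t*).
Proof. by move=> psdA v; have := psdA (v *m B); rewrite trmxC_mul !mulmxA. Qed.

Lemma psd1 n : psdmx (1%:M : 'M[C]_n).
Proof.
move=> v; rewrite mulmx1 mxE; apply: sumr_ge0 => i _.
by rewrite trmxCE mul_conjC_ge0.
Qed.

Lemma psd_gram n m (B : 'M[C]_(m, n)) : psdmx (B *m B ^t*).
Proof. by rewrite -[B in B *m _]mulmx1; apply/psd_conj/psd1. Qed.

Lemma psd0 n : psdmx (0 : 'M[C]_n).
Proof. by move=> v; rewrite mulmx0 mul0mx mxE. Qed.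

Lemma psdD n (A B : 'M[C]_n) : psdmx A -> psdmx B -> psdmx (A + B).
Proof. by move=> a b v; rewrite mulmxDr mulmxDl mxE addr_ge0. Qed.

Lemma psd_sum n (I : Type) (s : seq I) (P : pred I) (A : I -> 'M[C]_n) :
  (forall i, P i -> psdmx (A i)) -> psdmx (\sum_(i <- s | P i) A i).
Proof. exact: (big_ind (@psdmx R n) (@psd0 n) (@psdD n)). Qed.

Lemma psdZ n (c : C) (A : 'M[C]_n) : 0 <= c -> psdmx A -> psdmx (c *: A).
Proof. by move=> c0 a v; rewrite -scalemxAr -scalemxAl mxE mulr_ge0. Qed.

Lemma psd_diag_ge0 n (A : 'M[C]_n) i : psdmx A -> 0 <= A i i.
Proof. by move=> psdA; rewrite sandwich_delta. Qed.

Lemma hermitian_spectral n (A : 'M[C]_n) : A ^t* = A ->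
  A = (spectralmx A) ^t* *m diag_mx (spectral_diag A) *m spectralmx A.
Proof.
move=> hA; rewrite -(invmx_unitary (spectral_unitarymx A)).
apply/orthomx_spectralP/hermitian_normalmx.
by apply/is_hermitianmxP; rewrite expr0 scale1r hA.
Qed.

Lemma unitary_trmxCl n (U : 'M[C]_n) : U \is unitarymx -> U ^t* *m U = 1%:M.
Proof. by move=> uU; rewrite -(invmx_unitary uU) mulVmx // unitarymx_unit. Qed.

Lemma spectral_diagE n (A : 'M[C]_n) : A ^t* = A ->
  spectralmx A *m A *m (spectralmx A) ^t* = diag_mx (spectral_diag A).
Proof.
move=> hA; rewrite {2}(hermitian_spectral hA) !mulmxA.
rewrite (unitarymxP (spectral_unitarymx A)) mul1mx -mulmxA.
by rewrite (unitarymxP (spectral_unitarymx A)) mulmx1.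
Qed.

Lemma psd_spectral_ge0 n (A : 'M[C]_n) i : psdmx A -> 0 <= spectral_diag A 0 i.
Proof.
move=> psdA; have := psd_diag_ge0 i (psd_conj (spectralmx A) psdA).
by rewrite spectral_diagE ?psd_trmxC // mxE eqxx mulr1n.
Qed.

Lemma psd_factor n (A : 'M[C]_n) : psdmx A -> exists B : 'M[C]_n, A = B ^t* *m B.
Proof.
move=> psdA; pose d := \row_i sqrtC (spectral_diag A 0 i).
exists (diag_mx d *m spectralmx A).
rewrite trmxC_mul {1}(hermitian_spectral (psd_trmxC psdA)).
rewrite !mulmxA; congr (_ *m _); rewrite -!mulmxA; congr (_ *m _).
apply/matrixP=> i j; rewrite tr_diag_mx map_diag_mx mul_diag_mx !mxE.
case: (i =P j) => [_|_]; last by rewrite !mulr0n mulr0.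
rewrite !mulr1n /=.
rewrite conj_Creal ?ger0_real ?sqrtC_ge0 ?psd_spectral_ge0 //.
by rewrite -expr2 sqrtCK.
Qed.

Lemma psd_trace_mul_ge0 n (A B : 'M[C]_n) :
  psdmx A -> psdmx B -> 0 <= \tr (A *m B).
Proof.
move=> psdA /psd_factor[D ->]; rewrite mxtrace_mulC -mulmxA mxtrace_mulC.
by apply: sumr_ge0 => i _; apply/psd_diag_ge0/psd_conj.
Qed.

End PositiveOperators.

(** * Geometric means *)

Section GeometricMeans.
Variables (R : realType) (T : finType).
Implicit Types (p q : T -> R) (g : (T -> R) -> R).

Definition geometric_mean (I : {set T}) p : R :=
  (\prod_(i in I) p i) `^ (#|I|%:R^-1).

Record concave_mean g : Prop := ConcaveMean {
  mean_ge0 : forall p, (forall i, 0 <= p i) -> 0 <= g p;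
  mean_homogeneous : forall c p, 0 <= c -> (forall i, 0 <= p i) ->
    g (fun i => c * p i) = c * g p;
  mean_superadditive : forall p q,
    (forall i, 0 <= p i) -> (forall i, 0 <= q i) ->
    g p + g q <= g (fun i => p i + q i) }.

Lemma mean_superadditive_sum g (A : Type) (s : seq A) (p : A -> T -> R) :
  concave_mean g -> (forall a i, 0 <= p a i) ->
  \sum_(a <- s) g (p a) <= g (fun i => \sum_(a <- s) p a i).
Proof.
move=> cg p0; elim: s => [|a s IH].
  by rewrite big_nil; apply: (mean_ge0 cg) => i; rewrite big_nil.
rewrite big_cons.
have -> : (fun i => \sum_(b <- a :: s) p b i) =
          (fun i => p a i + \sum_(b <- s) p b i).
  by apply/funext => i; rewrite big_cons.
apply: le_trans (mean_superadditive cg _ _) => //; last first.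
  by move=> i; apply: sumr_ge0.
by rewrite lerD2l.
Qed.

Lemma concave_mean_sum (A : Type) (s : seq A) (P : pred A)
    (g : A -> (T -> R) -> R) :
  (forall a, P a -> concave_mean (g a)) ->
  concave_mean (fun p => \sum_(a <- s | P a) g a p).
Proof.
move=> cg; split=> [p p0|c p c0 p0|p q p0 q0].
- by apply: sumr_ge0 => a Pa; apply: mean_ge0 (cg a Pa) _ p0.
- by rewrite mulr_sumr; apply: eq_bigr => a Pa;
    apply: mean_homogeneous (cg a Pa) _ _ c0 p0.
- by rewrite -big_split; apply: ler_sum => a Pa;
    apply: mean_superadditive (cg a Pa) _ _ p0 q0.
Qed.

Lemma concave_mean_scale (c : R) g :
  0 <= c -> concave_mean g -> concave_mean (fun p => c * g p).
Proof.
move=> c0 cg; split=> [p p0|d p d0 p0|p q p0 q0].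
- by rewrite mulr_ge0 // (mean_ge0 cg).
- by rewrite (mean_homogeneous cg) // mulrCA.
- by rewrite -mulrDr ler_wpM2l // (mean_superadditive cg).
Qed.

Section OneMean.
Variable I : {set T}.
Hypothesis I0 : (0 < #|I|)%N.

Let k0 : (#|I|%:R : R) != 0.
Proof. by rewrite pnatr_eq0 -lt0n. Qed.

Lemma powR_root (x : R) : 0 <= x -> (x ^+ #|I|) `^ (#|I|%:R^-1) = x.
Proof. by move=> x0; rewrite -powR_mulrn // -powRrM divff // powRr1. Qed.

Lemma geometric_meanM p q : (forall i, 0 <= p i) -> (forall i, 0 <= q i) ->
  geometric_mean I (fun i => p i * q i) = geometric_mean I p * geometric_mean I q.
Proof.
by move=> p0 q0; rewrite /geometric_mean big_split /= powRM // prodr_ge0.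
Qed.

Lemma geometric_mean_cst (c : R) : 0 <= c -> geometric_mean I (fun=> c) = c.
Proof. by move=> c0; rewrite /geometric_mean prodr_const powR_root. Qed.

Lemma geometric_mean_eq0 p i : i \in I -> p i = 0 -> geometric_mean I p = 0.
Proof.
move=> iI pi0; rewrite /geometric_mean (bigD1 i) //= pi0 mul0r powR0 //.
by rewrite invr_eq0.
Qed.

Lemma geometric_mean_le_average p : (forall i, 0 <= p i) ->
  geometric_mean I p <= (\sum_(i in I) p i) / #|I|%:R.
Proof.
move=> p0; have m0 : 0 <= (\sum_(i in I) p i) / #|I|%:R.
  by rewrite divr_ge0 // sumr_ge0.
rewrite -[leRHS]powR_root // /geometric_mean ge0_ler_powR ?invr_ge0 //.
- by rewrite nnegrE prodr_ge0.
- by rewrite nnegrE exprn_ge0.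
- by apply: (leif_AGM (A := I) (E := p)).
Qed.

(* Mahler's inequality: where [s := p + q] has no zero on [I], divide by
   [geometric_mean I s] and compare with the arithmetic means of [p / s] and
   [q / s], which add up to [1]. *)
Lemma geometric_mean_concave : concave_mean (geometric_mean I).
Proof.
split=> [p p0|c p c0 p0|p q p0 q0].
- exact: powR_ge0.
- by rewrite geometric_meanM // geometric_mean_cst.
pose s i := p i + q i; have s0 i : 0 <= s i by rewrite addr_ge0.
have [/existsP[i /andP[iI /eqP si0]]|/existsPn sN0] :=
    boolP [exists i, (i \in I) && (s i == 0)].
  have /andP[/eqP pi0 /eqP qi0] : (p i == 0) && (q i == 0).
    by rewrite -paddr_eq0 //; apply/eqP.
  by rewrite !(geometric_mean_eq0 iI) // add0r powR_ge0.
have sV0 i : 0 <= (s i)^-1 by rewrite invr_ge0.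
have div_s t : (forall i, 0 <= t i) ->
    geometric_mean I t = geometric_mean I (fun i => t i / s i) * geometric_mean I s.
  move=> t0; rewrite -geometric_meanM //; last by move=> i; rewrite mulr_ge0.
  congr (_ `^ _); apply: eq_bigr => i iI.
  by rewrite mulfVK //; have := sN0 i; rewrite iI.
rewrite (div_s p) // (div_s q) // -mulrDl -[leRHS]mul1r.
apply: ler_wpM2r; first exact: powR_ge0.
apply: le_trans (lerD (geometric_mean_le_average _) (geometric_mean_le_average _)) _;
  try by move=> i; rewrite mulr_ge0.
rewrite -mulrDl -big_split /= (eq_bigr (fun=> 1)).
  by rewrite sumr_const divff.
by move=> i iI; rewrite -mulrDl divff //; have := sN0 i; rewrite iI.
Qed.

End OneMean.
End GeometricMeans.

(** * Measured fidelities *)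

Section MeasuredFidelities.
Variables (R : realType) (r : nat).
Local Notation C := R[i].
Implicit Types (g : ('I_r -> R) -> R).

Definition mean_fidelity g : fidelity R r :=
  on_commuting (fun n p => \sum_x g (fun i => p i x)).

(* Two eigenbases are related by a unitary [W] that connects only columns [x],
   [y] with equal joint eigenvalues, and [`|W x y| ^+ 2] is doubly stochastic. *)
Lemma joint_spectrum_sum g n (rho : 'I_r -> 'M[C]_n) p p' :
  joint_spectrum rho p -> joint_spectrum rho p' ->
  \sum_x g (fun i => p i x) = \sum_x g (fun i => p' i x).
Proof.
move=> [U uU eU] [V uV eV]; pose W := V *m U ^t*.
have uVK := unitarymxP uV; have uUK := unitarymxP uU.
have WW : W *m W ^t* = 1%:M.
  by rewrite trmxC_mul trmxCK !mulmxA -(mulmxA V) unitary_trmxCl // mulmx1.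
have WW' : W ^t* *m W = 1%:M.
  by rewrite trmxC_mul trmxCK !mulmxA -(mulmxA U) unitary_trmxCl // mulmx1.
have intertwine i x y : (p' i x)%:C * W x y = W x y * (p i y)%:C.
  have : V *m rho i *m U ^t* = V *m rho i *m U ^t* by [].
  rewrite {1}eV eU !mulmxA uVK mul1mx -!mulmxA uUK mulmx1 [in RHS]mulmxA -/W.
  rewrite mul_mx_diag mul_diag_mx => /matrixP /(_ x y).
  by rewrite [LHS]mxE [RHS]mxE !(mxE _ (fun _ _ => (_ i _)%:C)).
have swap x y : (g (fun i => p i y))%:C * (W x y * (W x y)^*%R) =
                (g (fun i => p' i x))%:C * (W x y * (W x y)^*%R).
  have [->|Wxy] := eqVneq (W x y) 0; first by rewrite !mul0r !mulr0.
  congr (_%:C * _); congr (g _); apply/funext => i.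
  have /eqP := intertwine i x y.
  rewrite mulrC (inj_eq (mulfI Wxy)) => /eqP /(congr1 (@complex.Re R)) /= ->.
  by [].
apply: (@complexI R); rewrite !rmorph_sum /=.
transitivity (\sum_y \sum_x (g (fun i => p i y))%:C * (W x y * (W x y)^*%R)).
  apply: eq_bigr => y _; rewrite -mulr_sumr -[LHS]mulr1; congr (_ * _).
  have /matrixP/(_ y y) := WW'; rewrite [LHS]mxE [RHS]mxE eqxx mulr1n => <-.
  by apply: eq_bigr => x _; rewrite trmxCE mulrC.
rewrite exchange_big; apply: eq_bigr => x _.
under eq_bigr do rewrite swap.
rewrite -mulr_sumr -[RHS]mulr1; congr (_ * _).
have /matrixP/(_ x x) := WW; rewrite [LHS]mxE [RHS]mxE eqxx mulr1n => <-.
by apply: eq_bigr => y _; rewrite trmxCE.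
Qed.

Lemma mean_fidelityE g n (rho : 'I_r -> 'M[C]_n) p :
  joint_spectrum rho p -> mean_fidelity g rho = \sum_x g (fun i => p i x).
Proof.
move=> jp; apply: joint_spectrum_sum (jp).
by apply: (@xgetPex _ 0 [set q | joint_spectrum rho q]); exists p.
Qed.

Definition prob n (A rho : 'M[C]_n) : R := complex.Re (\tr (A *m rho)).

Lemma prob_ge0 n (A rho : 'M[C]_n) : psdmx A -> psdmx rho -> 0 <= prob A rho.
Proof.
move=> psdA psdr; have := psd_trace_mul_ge0 psdA psdr.
by rewrite lecE => /andP[].
Qed.

Lemma probE n (A rho : 'M[C]_n) : psdmx A -> psdmx rho ->
  (prob A rho)%:C = \tr (A *m rho).
Proof. by move=> ? ?; apply/RRe_real/ger0_real/psd_trace_mul_ge0. Qed.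

Lemma prob1 n (rho : 'M[C]_n) : state rho -> prob 1%:M rho = 1.
Proof. by case=> _; rewrite /prob mul1mx => ->. Qed.

Lemma prob_sum n (T : finType) (A : T -> 'M[C]_n) rho :
  \sum_t prob (A t) rho = prob (\sum_t A t) rho.
Proof.
by rewrite /prob mulmx_suml [\tr _]raddf_sum raddf_sum.
Qed.

Lemma measurement_diag n m (L : 'I_m -> 'M[C]_n) rho : psdmx rho ->
  (forall x, psdmx (L x)) ->
  measurement L rho = diag_mx (\row_x (prob (L x) rho)%:C).
Proof.
move=> psdr psdL; apply/matrixP=> i j; rewrite summxE !mxE.
rewrite (bigD1 i) //= big1 ?addr0 => [|k ki]; last first.
  by rewrite !mxE [i == k]eq_sym (negbTE ki) mulr0.
by rewrite !mxE eqxx probE // [j == i]eq_sym mulr_natr.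
Qed.

Lemma diag_mx_inj n : injective (@diag_mx C n).
Proof.
move=> d e /matrixP de; apply/rowP=> i.
by have := de i i; rewrite !mxE eqxx !mulr1n.
Qed.

Lemma measurement_prob n m (L : 'I_m -> 'M[C]_n) rho rho' :
  psdmx rho -> psdmx rho' -> (forall x, psdmx (L x)) ->
  measurement L rho = measurement L rho' ->
  forall x, prob (L x) rho = prob (L x) rho'.
Proof.
move=> psdr psdr' psdL.
rewrite (measurement_diag psdr psdL) (measurement_diag psdr' psdL).
by move=> /diag_mx_inj /rowP e x; have := e x; rewrite !mxE => -[].
Qed.

Lemma joint_spectrum_measurement n m (L : 'I_m -> 'M[C]_n) (rho : 'I_r -> 'M[C]_n) :
  (forall i, psdmx (rho i)) -> (forall x, psdmx (L x)) ->
  joint_spectrum (fun i => measurement L (rho i))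
    (\matrix_(i, x) prob (L x) (rho i)).
Proof.
move=> psdr psdL; exists 1%:M; first by apply/unitarymxP; rewrite trmxC1 mul1mx.
move=> i; rewrite trmxC1 mul1mx mulmx1 measurement_diag //.
by congr diag_mx; apply/matrixP => a b; rewrite !mxE.
Qed.

Lemma mean_fidelity_measurement g n m (L : 'I_m -> 'M[C]_n) (rho : 'I_r -> 'M[C]_n) :
  (forall i, psdmx (rho i)) -> (forall x, psdmx (L x)) ->
  mean_fidelity g (fun i => measurement L (rho i)) =
    \sum_x g (fun i => prob (L x) (rho i)).
Proof.
move=> psdr psdL.
rewrite (mean_fidelityE g (joint_spectrum_measurement psdr psdL)).
by apply: eq_bigr => x _; congr (g _); apply/funext => i; rewrite mxE.
Qed.

Lemma measurement_commuting n m (L : 'I_m -> 'M[C]_n) (rho : 'I_r -> 'M[C]_n) :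
  (forall i, state (rho i)) -> povm L ->
  commuting_states (fun i => measurement L (rho i)).
Proof.
move=> st [psdL sumL].
have psdr i : psdmx (rho i) by case: (st i).
split=> [i|i j]; last first.
  rewrite (measurement_diag (psdr i) psdL) (measurement_diag (psdr j) psdL).
  exact: diag_mxC.
rewrite measurement_diag //; split.
  move=> v; rewrite mul_mx_diag mxE; apply: sumr_ge0 => x _.
  rewrite trmxCE !mxE mulrAC mulr_ge0 ?mul_conjC_ge0 //.
  by rewrite lecE /= eqxx prob_ge0.
rewrite mxtrace_diag; under eq_bigr do rewrite mxE.
by rewrite -rmorph_sum prob_sum sumL prob1.
Qed.

Lemma trivial_povm n : povm (fun _ : 'I_1 => 1%:M : 'M[C]_n).
Proof. by split=> [x|]; [exact: psd1 | rewrite big_ord1]. Qed.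

Definition indexed_povm (T : finType) n (L : T -> 'M[C]_n) : Prop :=
  (forall t, psdmx (L t)) /\ \sum_t L t = 1%:M.

Section Bounds.
Variable g : ('I_r -> R) -> R.
Hypothesis cg : concave_mean g.
Variables (n : nat) (rho : 'I_r -> 'M[C]_n).
Hypothesis psdr : forall i, psdmx (rho i).

Let values := [set v : R | exists m (L : 'I_m -> 'M[C]_n),
         povm L /\ v = @mean_fidelity g m (fun i => measurement L (rho i))].

Let values0 : values !=set0.
Proof. by eexists; exists 1%N, (fun=> 1%:M); split; first exact: trivial_povm. Qed.

Let values_lb : lbound values 0.
Proof.
move=> _ [m [L [[psdL _] ->]]]; rewrite mean_fidelity_measurement //.
by apply: sumr_ge0 => x _; apply: (mean_ge0 cg) => i; rewrite prob_ge0.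
Qed.

Lemma maximal_extension_le (T : finType) (L : T -> 'M[C]_n) : indexed_povm L ->
  maximal_extension (mean_fidelity g) rho <=
    \sum_t g (fun i => prob (L t) (rho i)).
Proof.
move=> [psdL sumL]; apply: ge_inf; first by exists 0.
exists #|T|, (fun x => L (enum_val x)); split.
  by split=> // ; rewrite -sumL [in RHS](big_enum_val (A := T)).
by rewrite mean_fidelity_measurement // [LHS](big_enum_val (A := T)).
Qed.

Lemma maximal_extension_ge c :
  (forall m (L : 'I_m -> 'M[C]_n), povm L ->
     c <= \sum_t g (fun i => prob (L t) (rho i))) ->
  c <= maximal_extension (mean_fidelity g) rho.
Proof.
move=> h; apply: lb_le_inf => // _ [m [L [pL ->]]].
by rewrite mean_fidelity_measurement //; [exact: h | case: pL].
Qed.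

Lemma maximal_extension_ge0 : 0 <= maximal_extension (mean_fidelity g) rho.
Proof. by apply: lb_le_inf. Qed.

Lemma maximal_extension_adherent e : 0 < e ->
  exists m (L : 'I_m -> 'M[C]_n), povm L /\
    \sum_t g (fun i => prob (L t) (rho i)) <
      maximal_extension (mean_fidelity g) rho + e.
Proof.
move=> e0; have [|_ [m [L [pL ->]]]] := @inf_adherent R values e e0.
  by split=> //; exists 0.
rewrite mean_fidelity_measurement //; last by case: pL.
by move=> lt; exists m, L.
Qed.

End Bounds.

End MeasuredFidelities.

(** * Channels and tensor slots *)

Section Channels.
Variable R : realType.
Local Notation C := R[i].

Lemma trace_mul_delta n (A : 'M[C]_n) i j : \tr (A *m delta_mx j i) = A i j.
Proof.
rewrite -(mul_delta_mx (0 : 'I_1)) mulmxA -colE mxtrace_mulC -rowE.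
by rewrite /mxtrace big_ord1 !mxE.
Qed.

Lemma trace_mul_inj n (A B : 'M[C]_n) :
  (forall X, \tr (A *m X) = \tr (B *m X)) -> A = B.
Proof. by move=> AB; apply/matrixP=> i j; rewrite -!trace_mul_delta. Qed.

(* [slot x] is the operator [<x| (x) I]. *)
Definition slot a n (x : 'I_a) : 'M[C]_(n, a * n) :=
  rowsub (fun i => mxtens_index (x, i)) 1%:M.

Lemma slot_block a n (x y : 'I_a) (M : 'M[C]_(a * n)) :
  slot n x *m M *m (slot n y) ^t* =
    \matrix_(i, j) M (mxtens_index (x, i)) (mxtens_index (y, j)).
Proof.
rewrite /slot -rowsubE; apply/matrixP=> i j.
rewrite mxE (bigD1 (mxtens_index (y, j))) //=.
rewrite big1 ?addr0 => [|k kj]; first by rewrite !mxE eqxx conjC1 mulr1.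
by rewrite !mxE eq_sym (negbTE kj) conjC0 mulr0.
Qed.

Lemma slot_block_inj a n (M M' : 'M[C]_(a * n)) :
  (forall x y, slot n x *m M *m (slot n y) ^t* = slot n x *m M' *m (slot n y) ^t*) ->
  M = M'.
Proof.
move=> MM; apply/matrixP=> i j.
case: (mxtens_indexP i) => x k; case: (mxtens_indexP j) => y l.
by have /matrixP/(_ k l) := MM x y; rewrite !slot_block !mxE.
Qed.

Lemma slot_orthonormal a n (x y : 'I_a) :
  slot n x *m (slot n y) ^t* = (x == y)%:R *: 1%:M.
Proof.
rewrite -[slot n x]mulmx1 slot_block; apply/matrixP=> i j; rewrite !mxE.
by rewrite (inj_eq (can_inj (@mxtens_indexK _ _))) xpair_eqE -natrM mulnb.
Qed.

Lemma slot_sum a n : \sum_(x < a) (slot n x) ^t* *m slot n x = 1%:M.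
Proof.
apply: slot_block_inj => y z; rewrite mulmx1 mulmx_sumr mulmx_suml.
rewrite (bigD1 y) //= big1 => [|x xy]; last first.
  by rewrite mulmxA slot_orthonormal eq_sym (negbTE xy) scale0r !mul0mx.
by rewrite addr0 mulmxA slot_orthonormal eqxx scale1r mul1mx.
Qed.

Lemma tensmx_delta a n (x : 'I_a) (A : 'M[C]_n) :
  tensmx (delta_mx x x) A = (slot n x) ^t* *m A *m slot n x.
Proof.
apply: slot_block_inj => y z; rewrite !mulmxA slot_orthonormal -!mulmxA.
rewrite slot_orthonormal -scalemxAr mulmx1 -scalemxAl mul1mx mulmxA slot_block.
apply/matrixP=> i j; rewrite mxE tensmxE !mxE [x == z]eq_sym.
by rewrite mulrA -natrM mulnb.
Qed.

Lemma completely_positive_psd n m (N : 'M[C]_n -> 'M[C]_m) (A : 'M[C]_n) :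
  completely_positive N -> psdmx A -> psdmx (N A).
Proof.
move=> cpN psdA.
pose X : 'M[C]_(1 * n) := (slot n ord0) ^t* *m A *m slot n ord0.
have psdX : psdmx X by rewrite /X -{2}(trmxCK (slot n _)); apply: psd_conj.
have := psd_conj (slot m ord0) (cpN 1%N X psdX).
rewrite /ampliation !big_ord1 -slot_block.
have id k (B : 'M[C]_k) :
    slot k (ord0 : 'I_1) *m ((slot k ord0) ^t* *m B *m slot k ord0) *m
      (slot k ord0) ^t* = B.
  by rewrite !mulmxA slot_orthonormal -!mulmxA slot_orthonormal eqxx
    scale1r mul1mx mulmx1.
by rewrite tensmx_delta !id.
Qed.

Definition dual_map n m (N : 'M[C]_n -> 'M[C]_m) (Y : 'M[C]_m) : 'M[C]_n :=
  \matrix_(i, j) \tr (Y *m N (delta_mx j i)).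

Lemma dual_mapE n m (N : {linear 'M[C]_n -> 'M[C]_m}) (Y : 'M[C]_m) X :
  \tr (dual_map N Y *m X) = \tr (Y *m N X).
Proof.
rewrite [in RHS](matrix_sum_delta X) linear_sum mulmx_sumr [\tr _ in RHS]raddf_sum /=.
rewrite [LHS]/mxtrace; under [LHS]eq_bigr do rewrite mxE.
rewrite [LHS]exchange_big /=.
apply: eq_bigr => i _.
rewrite linear_sum mulmx_sumr [\tr _ in RHS]raddf_sum /=.
apply: eq_bigr => j _; rewrite mxE.
by rewrite linearZ /= -scalemxAr mxtraceZ mulrC.
Qed.

Lemma dual_map_psd n m (N : {linear 'M[C]_n -> 'M[C]_m}) (Y : 'M[C]_m) :
  completely_positive N -> psdmx Y -> psdmx (dual_map N Y).
Proof.
move=> cpN psdY v.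
have -> : (v *m dual_map N Y *m v ^t*) 0 0 = \tr (dual_map N Y *m (v ^t* *m v)).
  by rewrite mulmxA mxtrace_mulC mulmxA /mxtrace big_ord1.
rewrite dual_mapE; apply: psd_trace_mul_ge0 => //.
apply: completely_positive_psd => //.
by rewrite -[X in _ *m X]trmxCK; apply: psd_gram.
Qed.

Lemma dual_map_povm n m (N : {linear 'M[C]_n -> 'M[C]_m}) k (L : 'I_k -> 'M[C]_m) :
  channel N -> povm L -> povm (fun x => dual_map N (L x)).
Proof.
move=> [cpN tpN] [psdL sumL]; split=> [x|]; first exact: dual_map_psd.
apply: trace_mul_inj => X; rewrite mul1mx -[RHS]tpN mulmx_suml [\tr _]raddf_sum /=.
under eq_bigr do rewrite dual_mapE.
by rewrite -[LHS](@raddf_sum _ _ (@mxtrace _ _)) -mulmx_suml sumL mul1mx.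
Qed.

End Channels.

Arguments slot {R a} n x.

(** * Data processing, symmetry and faithfulness *)

Lemma eq_maximal_extension (R : realType) r (F : fidelity R r) n
    (rho rho' : 'I_r -> 'M[R[i]]_n) :
  (forall m (L : 'I_m -> 'M[R[i]]_n), povm L ->
    F m (fun i => measurement L (rho i)) = F m (fun i => measurement L (rho' i))) ->
  maximal_extension F rho = maximal_extension F rho'.
Proof.
move=> E; apply: (congr1 (@inf R)); apply/seteqP.
split=> v [m [L [pL ->]]]; exists m, L; split.
- exact: pL.
- exact: E.
- exact: pL.
- exact/esym/E.
Qed.

Section ExtensionProperties.
Variables (R : realType) (r : nat).
Local Notation C := R[i].
Variable g : ('I_r -> R) -> R.
Hypothesis cg : concave_mean g.
Local Notation F := (mean_fidelity g).

Lemma state_psd n (rho : 'I_r -> 'M[C]_n) :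
  (forall i, state (rho i)) -> forall i, psdmx (rho i).
Proof. by move=> st i; case: (st i). Qed.

Lemma maximal_extension_data_processing :
  data_processing (@all_states R r) (maximal_extension F).
Proof.
move=> n m rho N st chN stN; apply: maximal_extension_ge => [|k L pL].
  exact: state_psd.
have [psdD sumD] := dual_map_povm chN pL.
apply: le_trans (maximal_extension_le cg (state_psd st) (conj psdD sumD)) _.
rewrite le_eqVlt; apply/orP; left; apply/eqP; apply: eq_bigr => x _.
by congr (g _); apply/funext => i; rewrite /prob dual_mapE.
Qed.

Lemma maximal_extension_symmetry : symmetry (@commuting_states R r) F ->
  symmetry (@all_states R r) (maximal_extension F).
Proof.
move=> symF n rho s st; apply: eq_maximal_extension => m L pL.
exact: (symF _ _ s (measurement_commuting st pL)).
Qed.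

Lemma rank_one_povm n (U : 'M[C]_n) : U \is unitarymx ->
  povm (fun x => (row x U) ^t* *m row x U).
Proof.
move=> uU; split=> [x|].
  by rewrite -[X in _ *m X]trmxCK; apply: psd_gram.
rewrite -(unitary_trmxCl uU); apply/matrixP=> i j; rewrite summxE [RHS]mxE.
by apply: eq_bigr => x _; rewrite mxE big_ord1 !mxE.
Qed.

Lemma faithful_mean_cst n (rho : 'M[C]_n) : state rho ->
  faithfulness (@commuting_states R r) F -> g (fun=> 1) = 1.
Proof.
move=> st faithF.
have pL := @trivial_povm R n.
have stc : forall i : 'I_r, state rho by [].
have := (faithF _ _ (measurement_commuting stc pL)).2 (fun _ _ => erefl).
rewrite (mean_fidelity_measurement g (state_psd stc)); last by case: pL.
by rewrite big_ord1 prob1.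
Qed.

Lemma maximal_extension_faithfulness :
  faithfulness (@commuting_states R r) F ->
  faithfulness (@all_states R r) (maximal_extension F).
Proof.
move=> faithF n rho st; have psdr := state_psd st.
split=> [ext1 i j|eqr].
  pose D := rho i - rho j.
  have hD : D ^t* = D by rewrite trmxCB !psd_trmxC.
  pose U := spectralmx D; have uU : U \is unitarymx by exact: spectral_unitarymx.
  have pL := rank_one_povm uU; set L := fun x => _ in pL; have [psdL sumL] := pL.
  have val1 : F (fun i => measurement L (rho i)) = 1.
    rewrite mean_fidelity_measurement //; apply/le_anti/andP; split; last first.
      by rewrite -ext1; apply: maximal_extension_le.
    have p0 x k : 0 <= prob (L x) (rho k) by exact: prob_ge0.
    rewrite -(faithful_mean_cst (st i) faithF).
    apply: le_trans (mean_superadditive_sum _ cg p0) _.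
    rewrite le_eqVlt; apply/orP; left; apply/eqP; congr (g _); apply/funext => k.
    by rewrite prob_sum sumL prob1.
  have /(_ i j) eqL := (faithF _ _ (measurement_commuting st pL)).1 val1.
  suff D0 : spectral_diag D = 0.
    apply/eqP; rewrite -subr_eq0 -/D (hermitian_spectral hD) D0.
    by rewrite raddf0 mulmx0 mul0mx.
  apply/rowP => x; rewrite [RHS]mxE.
  have := spectral_diagE hD => /matrixP /(_ x x); rewrite [RHS]mxE eqxx mulr1n => <-.
  rewrite sandwich_row -trace_mx11 mxtrace_mulC mulmxA mulmxBr raddfB /=.
  have trE : \tr (L x *m rho i) = \tr (L x *m rho j).
    rewrite -(probE (psdL x) (psdr i)) -(probE (psdL x) (psdr j)).
    by rewrite (measurement_prob (psdr i) (psdr j) psdL eqL).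
  by apply/eqP; rewrite subr_eq0; apply/eqP; exact: trE.
have val1 m (M : 'I_m -> 'M[C]_n) : povm M ->
    \sum_x g (fun i => prob (M x) (rho i)) = 1.
  move=> pL; rewrite -mean_fidelity_measurement //; last by case: pL.
  apply: (faithF _ _ (measurement_commuting st pL)).2 => i j.
  by rewrite (eqr i j).
apply/le_anti/andP; split; last first.
  by apply: maximal_extension_ge => // m M pM; rewrite val1.
rewrite -(val1 _ _ (@trivial_povm R n)).
exact: (maximal_extension_le cg psdr (@trivial_povm R n)).
Qed.

End ExtensionProperties.

(** * Direct sums *)

Section DirectSums.
Variables (R : realType) (r : nat).
Local Notation C := R[i].
Variable g : ('I_r -> R) -> R.
Hypothesis cg : concave_mean g.
Local Notation F := (mean_fidelity g).

Definition direct_sum a n (p : 'I_a -> R) (rho : 'I_a -> 'M[C]_n) : 'M[C]_(a * n) :=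
  \sum_x (p x)%:C *: tensmx (delta_mx x x : 'M[C]_a) (rho x).

Lemma direct_sum_psd a n (p : 'I_a -> R) (rho : 'I_a -> 'M[C]_n) :
  (forall x, 0 <= p x) -> (forall x, psdmx (rho x)) -> psdmx (direct_sum p rho).
Proof.
move=> p0 psdr; apply: psd_sum => x _; apply: psdZ; first by rewrite lecE /= eqxx p0.
by rewrite tensmx_delta -{2}(trmxCK (slot n x)); apply: psd_conj.
Qed.

Lemma prob_direct_sum a n (p : 'I_a -> R) (rho : 'I_a -> 'M[C]_n) M :
  prob M (direct_sum p rho) =
    \sum_x p x * prob (slot n x *m M *m (slot n x) ^t*) (rho x).
Proof.
rewrite /prob mulmx_sumr [\tr _]raddf_sum raddf_sum; apply: eq_bigr => x _.
rewrite -scalemxAr /= mxtraceZ tensmx_delta.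
have -> : \tr (M *m ((slot n x) ^t* *m rho x *m slot n x)) =
          \tr (slot n x *m M *m (slot n x) ^t* *m rho x).
  by rewrite mulmxA mxtrace_mulC !mulmxA.
by case: (\tr _) => u v /=; rewrite mul0r subr0.
Qed.

Lemma block_povm a n m (M : 'I_m -> 'M[C]_(a * n)) (x : 'I_a) : povm M ->
  povm (fun t => slot n x *m M t *m (slot n x) ^t*).
Proof.
move=> [psdM sumM]; split=> [t|]; first exact: psd_conj.
by rewrite -mulmx_suml -mulmx_sumr sumM mulmx1 slot_orthonormal eqxx scale1r.
Qed.

Lemma slot_povm a n (m : 'I_a -> nat) (L : forall x, 'I_(m x) -> 'M[C]_n) :
  (forall x, povm (L x)) ->
  indexed_povm (fun t : {x : 'I_a & 'I_(m x)} =>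
    (slot n (tag t)) ^t* *m L (tag t) (tagged t) *m slot n (tag t)).
Proof.
move=> pL; split=> [[x y]|] /=.
  by rewrite -{2}(trmxCK (slot n x)); apply: psd_conj; case: (pL x).
rewrite -(sig_big_dep (fun=> true) (fun _ _ => true)
  (fun x y => (slot n x) ^t* *m L x y *m slot n x)) /= -[RHS](slot_sum R a n).
apply: eq_bigr => x _; rewrite -mulmx_suml -mulmx_sumr.
by case: (pL x) => _ ->; rewrite mulmx1.
Qed.

Lemma prob_slot a n (p : 'I_a -> R) (rho : 'I_a -> 'M[C]_n) x (A : 'M[C]_n) :
  prob ((slot n x) ^t* *m A *m slot n x) (direct_sum p rho) = p x * prob A (rho x).
Proof.
rewrite prob_direct_sum (bigD1 x) //= big1 ?addr0 => [|y yx].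
  rewrite !mulmxA slot_orthonormal eqxx scale1r mul1mx.
  by rewrite -mulmxA slot_orthonormal eqxx scale1r mulmx1.
rewrite !mulmxA slot_orthonormal (negbTE yx) scale0r !mul0mx.
by rewrite /prob mul0mx mxtrace0 mulr0.
Qed.

Lemma maximal_extension_direct_sum :
  direct_sum_property (@all_states R r) (maximal_extension F).
Proof.
move=> a n p rho p0 p1 st.
have psdr x i : psdmx (rho x i) by case: (st x i).
have psdS i : psdmx (direct_sum p (fun x => rho x i)) by apply: direct_sum_psd.
apply/le_anti/andP; split.
  apply/ler_addgt0Pr => e e0.
  pose P x (mL : {m : nat & 'I_m -> 'M[C]_n}) := povm (tagged mL) /\
    \sum_t g (fun i => prob (tagged mL t) (rho x i)) <
      maximal_extension F (rho x) + e.
  have /choice[f fP] : forall x, exists mL, P x mL.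
    move=> x; have [m [L [pL lt]]] := maximal_extension_adherent cg (psdr x) e0.
    by exists (existT _ m L).
  have pL x : povm (tagged (f x)) by case: (fP x).
  apply: le_trans (maximal_extension_le cg psdS (slot_povm pL)) _.
  have -> : \sum_(t : {x : 'I_a & 'I_(tag (f x))}) g (fun i => prob
        ((slot n (tag t)) ^t* *m tagged (f (tag t)) (tagged t) *m slot n (tag t))
        (direct_sum p (fun x => rho x i))) =
      \sum_x p x * \sum_y g (fun i => prob (tagged (f x) y) (rho x i)).
    under [RHS]eq_bigr do rewrite mulr_sumr.
    rewrite (sig_big_dep (fun=> true) (fun _ _ => true)) /=.
    apply: eq_bigr => -[x y] _ /=.
    rewrite -(mean_homogeneous cg) //; last first.
      by move=> i; apply: prob_ge0 => //; case: (pL x).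
    by congr (g _); apply/funext => i; rewrite prob_slot.
  apply: (@le_trans _ _ (\sum_x p x * (maximal_extension F (rho x) + e))).
    by apply: ler_sum => x _; apply: ler_wpM2l => //; apply: ltW; case: (fP x).
  under eq_bigr do rewrite mulrDr.
  by rewrite big_split /= -mulr_suml p1 mul1r.
apply: maximal_extension_ge => // m M pM.
apply: (@le_trans _ _ (\sum_x p x *
    \sum_t g (fun i => prob (slot n x *m M t *m (slot n x) ^t*) (rho x i)))).
  apply: ler_sum => x _; apply: ler_wpM2l => //.
  exact: (maximal_extension_le cg (psdr x) (block_povm x pM)).
under eq_bigr do rewrite mulr_sumr.
rewrite exchange_big; apply: ler_sum => t _.
have b0 x i : 0 <= prob (slot n x *m M t *m (slot n x) ^t*) (rho x i).
  by apply: prob_ge0 => //; apply: psd_conj; case: pM.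
under eq_bigr do rewrite -(mean_homogeneous cg) //.
have pb0 x i : 0 <= p x * prob (slot n x *m M t *m (slot n x) ^t*) (rho x i).
  exact: mulr_ge0.
apply: le_trans (mean_superadditive_sum _ cg pb0) _.
rewrite le_eqVlt; apply/orP; left; apply/eqP; congr (g _); apply/funext => i.
by rewrite -prob_direct_sum.
Qed.

End DirectSums.

(** * Orthogonality *)

Section Orthogonality.
Variables (R : realType) (r : nat).
Local Notation C := R[i].
Variable g : ('I_r -> R) -> R.
Hypothesis cg : concave_mean g.
Local Notation F := (mean_fidelity g).

Definition vanishes_below (k : nat) : Prop := forall p : 'I_r -> R,
  (forall i, 0 <= p i) -> (#|[pred i | p i != 0%R]| < k)%N -> g p = 0.

Definition diag_conj n (U : 'M[C]_n) (d : 'rV[C]_n) : 'M[C]_n :=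
  U ^t* *m diag_mx d *m U.

Lemma diag_conjM n (U : 'M[C]_n) (d e : 'rV[C]_n) : U \is unitarymx ->
  diag_conj U d *m diag_conj U e = diag_conj U (\row_i (d 0 i * e 0 i)).
Proof.
move=> uU; rewrite /diag_conj -mulmx_diag !mulmxA.
by rewrite -(mulmxA (U ^t* *m diag_mx d) U) (unitarymxP uU) mulmx1.
Qed.

Lemma diag_conj_trmxC n (U : 'M[C]_n) (d : 'rV[C]_n) : (forall i, d 0 i \is Num.real) ->
  (diag_conj U d) ^t* = diag_conj U d.
Proof.
move=> rd; rewrite /diag_conj !trmxC_mul trmxCK mulmxA tr_diag_mx map_diag_mx.
suff -> : map_mx Num.conj d = d by [].
by apply/rowP=> i; rewrite mxE conj_Creal.
Qed.

Lemma support_projection n (A : 'M[C]_n) : psdmx A ->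
  exists P S : 'M[C]_n,
    [/\ P ^t* = P, P *m P = P, P *m A = A, P = A *m S & P = S *m A].
Proof.
move=> psdA; pose U := spectralmx A; pose d := spectral_diag A.
have uU : U \is unitarymx by exact: spectral_unitarymx.
have eA : A = diag_conj U d by apply/hermitian_spectral/psd_trmxC.
pose supp : 'rV[C]_n := \row_i (d 0 i != 0)%:R.
pose dV : 'rV[C]_n := \row_i (d 0 i)^-1.
have suppE i : supp 0 i = (d 0 i != 0)%:R by rewrite mxE.
have dVE i : dV 0 i = (d 0 i)^-1 by rewrite mxE.
exists (diag_conj U supp), (diag_conj U dV); split.
- by apply: diag_conj_trmxC => i; rewrite suppE realn.
- rewrite (diag_conjM _ _ uU); congr (diag_conj _ _); apply/rowP=> i; rewrite mxE suppE.
  by case: (_ != 0); rewrite ?mulr1 ?mulr0.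
- rewrite eA (diag_conjM _ _ uU); congr (diag_conj _ _).
  apply/rowP=> i; rewrite mxE suppE.
  by have [->|_] := eqVneq (d 0 i) 0; rewrite ?mulr0 ?mul1r.
- rewrite eA (diag_conjM _ _ uU); congr (diag_conj _ _).
  apply/rowP=> i; rewrite [RHS]mxE suppE dVE.
  by have [->|d0] := eqVneq (d 0 i) 0; rewrite ?mul0r ?divff.
- rewrite eA (diag_conjM _ _ uU); congr (diag_conj _ _).
  apply/rowP=> i; rewrite [RHS]mxE suppE dVE.
  by have [->|d0] := eqVneq (d 0 i) 0; rewrite ?mulr0 ?mulVf.
Qed.

Lemma projection_psd n (P : 'M[C]_n) : P ^t* = P -> P *m P = P -> psdmx P.
Proof. by move=> hP PP; rewrite -PP -{2}hP; apply: psd_gram. Qed.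

Lemma maximal_extension_eq0 n (rho : 'I_r -> 'M[C]_n)
    (T : finType) (L : T -> 'M[C]_n) k :
  vanishes_below k -> (forall i, psdmx (rho i)) -> indexed_povm L ->
  (forall t, (#|[pred i | prob (L t) (rho i) != 0%R]| < k)%N) ->
  maximal_extension F rho = 0.
Proof.
move=> vk psdr pL small; apply/le_anti/andP; split; last exact: maximal_extension_ge0.
apply: le_trans (maximal_extension_le cg psdr pL) _; rewrite big1 // => t _.
by apply: vk => // i; apply: prob_ge0 => //; case: pL.
Qed.

Lemma maximal_extension_weak_orthogonality : vanishes_below 2 ->
  weak_orthogonality (maximal_extension F).
Proof.
move=> v2 n rho st orth; have psdr := state_psd st.
have /choice[P] := fun i => support_projection (psdr i).
move=> /choice[S PS].
have hP i : P i ^t* = P i by case: (PS i).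
have PP i : P i *m P i = P i by case: (PS i).
have Pr i : P i *m rho i = rho i by case: (PS i).
have Prho i j : i != j -> P i *m rho j = 0.
  by move=> ij; case: (PS i) => _ _ _ _ ->; rewrite -mulmxA orth // mulmx0.
have Porth i j : i != j -> P i *m P j = 0.
  by move=> ij; case: (PS j) => _ _ _ -> _; rewrite mulmxA Prho // mul0mx.
pose Q := 1%:M - \sum_i P i.
have PQ i : P i *m Q = 0.
  rewrite mulmxBr mulmx1 mulmx_sumr (bigD1 i) //= PP big1 ?addr0 ?subrr //.
  by move=> j ji; rewrite Porth // eq_sym.
have Qr j : Q *m rho j = 0.
  rewrite mulmxBl mul1mx mulmx_suml (bigD1 j) //= Pr big1 ?addr0 ?subrr //.
  by move=> i ij; rewrite Prho.
have hQ : Q ^t* = Q.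
  rewrite trmxCB trmxC1; congr (_ - _); apply/matrixP=> i j.
  rewrite trmxCE !summxE rmorph_sum; apply: eq_bigr => k _.
  by rewrite -[in RHS]hP trmxCE.
have QQ : Q *m Q = Q.
  by rewrite {1}/Q mulmxBl mul1mx mulmx_suml big1 ?subr0.
pose L (t : option 'I_r) := if t is Some i then P i else Q.
have pL : indexed_povm L.
  split=> [[i|]|]; [exact: projection_psd (hP i) (PP i)
    | exact: projection_psd hQ QQ |].
  rewrite (bigD1 None) //= (reindex_omap Some id) /=; last by case.
  rewrite (eq_bigl predT) => [|i]; last by rewrite eqxx.
  by rewrite /= /Q subrK.
apply: (maximal_extension_eq0 v2 psdr pL) => -[i|] /=.
  rewrite ltnS -(card1 i). apply/subset_leq_card/fintype.subsetP=> j; rewrite !inE.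
  by apply: contraR => ji; rewrite /prob Prho ?mxtrace0 // eq_sym.
by rewrite eq_card0 // => i; rewrite !inE /prob Qr mxtrace0 eqxx.
Qed.

Lemma psd_cauchy_schwarz n (A : 'M[C]_n) (u v : 'rV[C]_n) : psdmx A ->
  `|(u *m A *m v ^t*) 0 0| ^+ 2 <=
    (u *m A *m u ^t*) 0 0 * (v *m A *m v ^t*) 0 0.
Proof.
move=> /psd_factor[B ->].
have E (x y : 'rV[C]_n) : (x *m (B ^t* *m B) *m y ^t*) 0 0 =
    dotmx (x *m B ^t*) (y *m B ^t*).
  by rewrite dotmxE trmxC_mul trmxCK !mulmxA.
by rewrite !E; exact: (CauchySchwarz (@dotmx C n)).
Qed.

Lemma row_le_prob n (A : 'M[C]_n) (D : 'M[C]_n) k : psdmx A ->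
  (row k D *m A *m (row k D) ^t*) 0 0 <= (prob A (D ^t* *m D))%:C.
Proof.
move=> psdA.
have psdD : psdmx (D ^t* *m D) by rewrite -{2}(trmxCK D); apply: psd_gram.
rewrite probE // -sandwich_row.
have -> : \tr (A *m (D ^t* *m D)) = \tr (D *m A *m D ^t*).
  by rewrite mulmxA mxtrace_mulC mulmxA.
rewrite /mxtrace (bigD1 k) //= lerDl; apply: sumr_ge0 => i _.
exact/psd_diag_ge0/psd_conj.
Qed.

Lemma overlap_le_affinity n m (L : 'I_m -> 'M[C]_n) (A B : 'M[C]_n) k l : povm L ->
  `|(A *m B ^t*) k l| <=
    (\sum_x Num.sqrt (prob (L x) (A ^t* *m A) * prob (L x) (B ^t* *m B)))%:C.
Proof.
move=> [psdL sumL].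
have -> : A *m B ^t* = \sum_x A *m L x *m B ^t*.
  by rewrite -mulmx_suml -mulmx_sumr sumL mulmx1.
rewrite summxE rmorph_sum; apply: le_trans (ler_norm_sum _ _ _) _.
apply: ler_sum => x _ /=; rewrite sandwich_row.
have CS := psd_cauchy_schwarz (row k A) (row l B) (psdL x).
have gram_psd (D : 'M[C]_n) : psdmx (D ^t* *m D).
  by rewrite -{2}(trmxCK D); apply: psd_gram.
have a0 : 0 <= prob (L x) (A ^t* *m A) by apply: prob_ge0.
have : `|(row k A *m L x *m (row l B) ^t*) 0 0| ^+ 2 <=
    (prob (L x) (A ^t* *m A) * prob (L x) (B ^t* *m B))%:C.
  apply: le_trans CS _; rewrite rmorphM /=.
  by apply: ler_pM; rewrite ?row_le_prob //; apply: psdL.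
rewrite normc_def -rmorphXn /= !lecR => h.
by rewrite -[leLHS]ger0_norm ?sqrtr_ge0 // -sqrtr_sqr ler_sqrt // mulr_ge0 // prob_ge0.
Qed.

Lemma maximal_extension_eq0_orthogonal c n (rho : 'I_r -> 'M[C]_n) :
  0 < c ->
  (forall p i j, (forall i, 0 <= p i) -> i != j -> c * Num.sqrt (p i * p j) <= g p) ->
  all_states rho -> maximal_extension F rho = 0 -> Defs.pairwise_orthogonal rho.
Proof.
move=> c0 gc st ext0 i j ij; have psdr := state_psd st.
have [A eA] := psd_factor (psdr i); have [B eB] := psd_factor (psdr j).
suff AB0 : A *m B ^t* = 0.
  by rewrite eA eB mulmxA -(mulmxA (A ^t*)) AB0 mulmx0 mul0mx.
apply/matrixP=> k l; rewrite [RHS]mxE; apply/normr0_eq0.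
rewrite normc_def; set b := Num.sqrt _.
suff : c * b <= maximal_extension F rho.
  rewrite ext0 pmulr_rle0 // => b0; congr (_%:C).
  by apply/le_anti; rewrite b0 sqrtr_ge0.
apply: maximal_extension_ge => // m L pL.
have p0 x y : 0 <= prob (L x) (rho y) by apply: prob_ge0 => //; case: pL.
apply: (@le_trans _ _ (\sum_t c * Num.sqrt (prob (L t) (rho i) * prob (L t) (rho j)))).
  rewrite -mulr_sumr ler_pM2l // -lecR.
  by have := overlap_le_affinity A B k l pL; rewrite normc_def -eA -eB.
by apply: ler_sum => x _; exact: (gc (fun y => prob (L x) (rho y))).
Qed.

(* The first two states coincide, the others are orthogonal to them and to each
   other, so that a measurement in the common eigenbasis never gives positive
   probability to one outcome in more than two of the states. *)
Lemma maximal_extension_converse_fails : (2 <= r)%N -> vanishes_below 3 ->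
  converse_orthogonality_fails (maximal_extension F).
Proof.
move=> r2 v3; pose i0 : 'I_r := Ordinal (ltnW r2); pose i1 : 'I_r := Ordinal r2.
pose s i := if i == i1 then i0 else i.
pose proj (i : 'I_r) : 'M[C]_r := delta_mx i i.
have projP i : proj i *m proj i = proj i by rewrite mul_delta_mx.
have psdp i : psdmx (proj i).
  apply: projection_psd => //; apply/matrixP=> a b.
  by rewrite !mxE andbC rmorph_nat.
have st i : state (proj (s i)).
  by split=> //; rewrite -[proj _]mul1mx trace_mul_delta mxE eqxx.
exists r, (fun i => proj (s i)); split=> //; last first.
  move=> /(_ i0 i1 isT) /matrixP /(_ i0 i0); rewrite /s eqxx /= projP !mxE eqxx.
  by move/eqP; rewrite oner_eq0.
have pP : indexed_povm proj.
  by split=> //; rewrite [RHS]mx1_sum_delta.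
apply: (maximal_extension_eq0 v3 _ pP) => // x.
apply: (@leq_ltn_trans #|[set x; i1]%SET|); last by rewrite cards2; case: eqP.
apply/subset_leq_card/fintype.subsetP=> i; rewrite !inE; apply: contraR.
rewrite negb_or => /andP[ix ii1]; rewrite /prob trace_mul_delta /s (negbTE ii1).
by rewrite mxE (negbTE ix) andbF.
Qed.

End Orthogonality.

(** * The classical fidelities *)

Section ClassicalFidelities.
Variables (R : realType) (r : nat).
Implicit Types (p : 'I_r -> R).

Lemma eq_on_commuting (f f' : forall n, 'M[R]_(r, n) -> R) :
  (forall n q, f n q = f' n q) -> on_commuting f = on_commuting f'.
Proof.
move=> ff; apply: functional_extensionality_dep => n.
by apply: functional_extensionality_dep => rho; rewrite /on_commuting ff.
Qed.

Lemma eq_concave_mean (g g' : ('I_r -> R) -> R) :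
  (forall p, (forall i, 0 <= p i) -> g p = g' p) ->
  concave_mean g -> concave_mean g'.
Proof.
move=> gg cg; split=> [p p0|c p c0 p0|p q p0 q0].
- by rewrite -gg // (mean_ge0 cg).
- by rewrite -!gg ?(mean_homogeneous cg) // => i; rewrite mulr_ge0.
- by rewrite -!gg ?(mean_superadditive cg) // => i; rewrite addr_ge0.
Qed.

Lemma vanishes_below_leq (g : ('I_r -> R) -> R) k k' :
  (k <= k')%N -> vanishes_below g k' -> vanishes_below g k.
Proof. by move=> kk v p p0 lt; apply: v => //; apply: leq_trans kk. Qed.

Lemma geometric_mean_vanishes (I : {set 'I_r}) :
  (0 < #|I|)%N -> vanishes_below (@geometric_mean R _ I) #|I|.
Proof.
move=> I0 p p0 small; have [/existsP[i /andP[iI /eqP pi0]]|/existsPn h] :=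
    boolP [exists i, (i \in I) && (p i == 0)].
  exact: geometric_mean_eq0 pi0.
have : (#|I| <= #|[pred i | p i != 0%R]|)%N.
  apply/subset_leq_card/fintype.subsetP => i iI; rewrite !inE.
  by have := h i; rewrite iI.
by rewrite leqNgt small.
Qed.

Definition pairwise_mean p : R :=
  2 / (r%:R * (r%:R - 1)) *
    \sum_(i < r) \sum_(j < r | (i < j)%N) Num.sqrt (p i * p j).

Definition kwise_mean (k : nat) p : R :=
  ('C(r, k)%:R)^-1 *
    \sum_(I : {set 'I_r} | #|I| == k) (\prod_(i in I) p i) `^ (k%:R^-1).

Definition matusita_mean p : R := (\prod_i p i) `^ (r%:R^-1).

Lemma average_pairwise_fidelityE :
  @average_pairwise_fidelity R r = mean_fidelity pairwise_mean.
Proof.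
apply: eq_on_commuting => n q; rewrite -mulr_sumr exchange_big; congr (_ * _).
by apply: eq_bigr => i _; rewrite exchange_big.
Qed.

Lemma matusita_fidelityE : @matusita_fidelity R r = mean_fidelity matusita_mean.
Proof. by []. Qed.

Lemma average_kwise_fidelityE k :
  @average_kwise_fidelity R r k = mean_fidelity (kwise_mean k).
Proof.
by apply: eq_on_commuting => n q; rewrite -mulr_sumr exchange_big.
Qed.

Lemma pairwise_coef_gt0 : (2 <= r)%N -> 0 < 2 / (r%:R * (r%:R - 1)) :> R.
Proof.
move=> r2; rewrite divr_gt0 // mulr_gt0 ?subr_gt0 ?ltr1n // ltr0n.
exact: ltnW.
Qed.

Lemma sqrt_geometric_mean p i j : (forall i, 0 <= p i) -> i != j ->
  geometric_mean [set i; j]%SET p = Num.sqrt (p i * p j).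
Proof.
move=> p0 ij; rewrite /geometric_mean cards2 ij big_setU1 ?inE //= big_set1.
by rewrite powR12_sqrt // mulr_ge0.
Qed.

Lemma pairwise_mean_concave : (2 <= r)%N -> concave_mean pairwise_mean.
Proof.
move=> r2; pose gm := fun p => \sum_(i < r) \sum_(j < r | (i < j)%N)
  geometric_mean [set i; j]%SET p.
apply: (@eq_concave_mean (fun p => 2 / (r%:R * (r%:R - 1)) * gm p)) => [p p0|].
  congr (_ * _); apply: eq_bigr => i _; apply: eq_bigr => j ij.
  by rewrite sqrt_geometric_mean // neq_ltn ij.
apply/concave_mean_scale; first exact/ltW/pairwise_coef_gt0.
apply: concave_mean_sum => i _; apply: concave_mean_sum => j _.
by apply: geometric_mean_concave; rewrite cards2.
Qed.

Lemma pairwise_mean_ge p i j : (2 <= r)%N -> (forall i, 0 <= p i) -> i != j ->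
  2 / (r%:R * (r%:R - 1)) * Num.sqrt (p i * p j) <= pairwise_mean p.
Proof.
move=> r2 p0; wlog ij : i j / (i < j)%N => [th|_].
  rewrite neq_ltn => /orP[lt|lt]; first by apply: th; rewrite // neq_ltn lt.
  by rewrite mulrC [p i * _]mulrC mulrC; apply: th; rewrite // neq_ltn lt.
rewrite ler_pM2l ?pairwise_coef_gt0 // (bigD1 i) //= (bigD1 j) //= -addrA lerDl.
by rewrite addr_ge0 // sumr_ge0 // => k _; rewrite ?sqrtr_ge0 // sumr_ge0.
Qed.

Lemma pairwise_mean_vanishes : vanishes_below pairwise_mean 2.
Proof.
move=> p p0 small; rewrite /pairwise_mean big1 ?mulr0 // => i _.
rewrite big1 // => j ij; have ne : i != j by rewrite neq_ltn ij.
rewrite -sqrt_geometric_mean //.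
by apply: geometric_mean_vanishes; rewrite ?cards2 ?ne.
Qed.

Lemma kwise_meanE k p : kwise_mean k p =
  ('C(r, k)%:R)^-1 * \sum_(I : {set 'I_r} | #|I| == k) geometric_mean I p.
Proof. by congr (_ * _); apply: eq_bigr => I /eqP <-. Qed.

Lemma kwise_mean_concave k : (0 < k)%N -> concave_mean (kwise_mean k).
Proof.
move=> k0; rewrite (funext (kwise_meanE k)).
apply: concave_mean_scale; first by rewrite invr_ge0.
apply: concave_mean_sum => I /eqP Ik.
by apply: geometric_mean_concave; rewrite Ik.
Qed.

Lemma kwise_mean_vanishes k : (0 < k)%N -> vanishes_below (kwise_mean k) k.
Proof.
move=> k0 p p0 small; rewrite kwise_meanE big1 ?mulr0 // => I /eqP Ik.
by apply: geometric_mean_vanishes; rewrite ?Ik.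
Qed.

Lemma matusita_meanE : matusita_mean = geometric_mean [set: 'I_r]%SET.
Proof.
apply/funext => p; rewrite /matusita_mean /geometric_mean cardsT card_ord.
by congr (_ `^ _); apply: eq_bigl => i; rewrite inE.
Qed.

Lemma matusita_mean_concave : (0 < r)%N -> concave_mean matusita_mean.
Proof.
move=> r0; rewrite matusita_meanE; apply: geometric_mean_concave.
by rewrite cardsT card_ord.
Qed.

Lemma matusita_mean_vanishes : (0 < r)%N -> vanishes_below matusita_mean r.
Proof.
move=> r0; rewrite matusita_meanE -[X in vanishes_below _ X](card_ord r) -cardsT.
by apply: geometric_mean_vanishes; rewrite cardsT card_ord.
Qed.

Lemma classical_fidelity_mean F : (2 <= r)%N -> classical_fidelity F ->
  exists2 g : ('I_r -> R) -> R, concave_mean g & F = mean_fidelity g.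
Proof.
move=> r2 [->|->|[k [_ /andP[k2 _] ->]]].
- exists pairwise_mean; last exact: average_pairwise_fidelityE.
  exact: pairwise_mean_concave.
- exists matusita_mean; last exact: matusita_fidelityE.
  by apply: matusita_mean_concave; apply: ltnW.
- exists (kwise_mean k); last exact: average_kwise_fidelityE.
  by apply: kwise_mean_concave; apply: ltnW.
Qed.

End ClassicalFidelities.

Theorem mainTheorem16 (R : realType) (r : nat) (hr : (2 <= r)%N) :
  (* (a) *)
  (forall F : fidelity R r, classical_fidelity F ->
     data_processing (@commuting_states R r) F ->
     symmetry (@commuting_states R r) F ->
     faithfulness (@commuting_states R r) F ->
     direct_sum_property (@commuting_states R r) F ->
     [/\ data_processing (@all_states R r) (maximal_extension F),
         symmetry (@all_states R r) (maximal_extension F),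
         faithfulness (@all_states R r) (maximal_extension F)
       & direct_sum_property (@all_states R r) (maximal_extension F)])
  /\
  (* (b) *)
  orthogonality (maximal_extension (@average_pairwise_fidelity R r))
  /\
  (* (c) *)
  [/\ weak_orthogonality (maximal_extension (@matusita_fidelity R r)),
      (3 <= r)%N ->
        converse_orthogonality_fails
          (maximal_extension (@matusita_fidelity R r)),
      forall k : nat, (3 <= r)%N -> (2 <= k <= r)%N ->
        weak_orthogonality (maximal_extension (@average_kwise_fidelity R r k))
    & forall k : nat, (3 <= r)%N -> (3 <= k <= r)%N ->
        converse_orthogonality_fails
          (maximal_extension (@average_kwise_fidelity R r k))].
Proof.
have r0 : (0 < r)%N by exact: ltnW.
have cpair := pairwise_mean_concave R hr.
have cmat := matusita_mean_concave R r0.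
split=> [F /(classical_fidelity_mean hr)[g cg ->] _ symF faithF _|].
  split; [exact: maximal_extension_data_processing
         | exact: maximal_extension_symmetry
         | exact: maximal_extension_faithfulness
         | exact: maximal_extension_direct_sum].
split=> [n rho st|].
  rewrite average_pairwise_fidelityE; split.
    apply: maximal_extension_eq0_orthogonal (pairwise_coef_gt0 R hr) _ st => //.
    by move=> p i j; apply: pairwise_mean_ge.
  by apply: maximal_extension_weak_orthogonality => //; apply: pairwise_mean_vanishes.
rewrite matusita_fidelityE; split=> [|r3|k r3 /andP[k2 kr]|k r3 /andP[k3 kr]].
- apply: maximal_extension_weak_orthogonality => //.
  exact: (vanishes_below_leq hr (matusita_mean_vanishes r0)).
- apply: maximal_extension_converse_fails => //.
  exact: (vanishes_below_leq r3 (matusita_mean_vanishes r0)).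
- have k0 : (0 < k)%N by exact: ltnW.
  rewrite average_kwise_fidelityE; apply: maximal_extension_weak_orthogonality.
    exact: kwise_mean_concave.
  exact: (vanishes_below_leq k2 (kwise_mean_vanishes k0)).
- have k0 : (0 < k)%N by apply: leq_trans k3.
  rewrite average_kwise_fidelityE; apply: maximal_extension_converse_fails => //.
    exact: kwise_mean_concave.
  exact: (vanishes_below_leq k3 (kwise_mean_vanishes k0)).
Qed.
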